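(* For every fixed integer $k \ge 3$ there exist minimal unsatisfiable $k$-SAT formulas on $n$ variables with $\Omega(n^k)$ clauses; that is, for every integer $k \geq 3$ there exist a constant $c_k > 0$ and an integer $n_0(k)$ such that for every integer $n \geq n_0(k)$ there is a minimal unsatisfiable $k$-SAT formula $F=(V,C)$ with $|V| = n$ and $|C| \geq c_k\, n^k$.
   Context: Given a finite set $V=\{x_1,\dots,x_n\}$ of boolean variables, a literal is a variable $x_i$ or its negation $\overline{x}_i$; $\overline{V}=\{\overline{x}_1,\dots,\overline{x}_n\}$. A clause is a disjunction of literals, regarded as a finite set of literals; a $k$-clause is a clause of size $k$ (i.e. consisting of $k$ distinct literals). A (CNF) formula is a pair $F=(V,C)$ where $V$ is a finite set of variables and $C$ is a finite set of clauses over the literals $V\cup\overline{V}$, understood as the conjunction of the clauses in $C$ (it is not required that every variable of $V$ occurs in some clause). A $k$-SAT formula is a formula all of whose clauses are $k$-clauses. A formula is satisfiable if there is an assignment of truth values to the variables making every clause true. A formula $F=(V,C)$ is minimal unsatisfiable if it is not satisfiable, but for every clause $c\in C$ the formula $(V,C\setminus\{c\})$ is satisfiable. *)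

(* Defs.v *)
From mathcomp Require Import all_boot.

Set Implicit Arguments.
Unset Strict Implicit.
Unset Printing Implicit Defensive.

(* (x, true) is the literal x and (x, false) is its negation. *)
Definition literal (V : finType) : finType := (V * bool)%type.

(* Clauses are arbitrary sets of literals: containing both a variable and its
   negation is not excluded. *)
Definition clause (V : finType) : finType := {set literal V}.

(* Every element of [vars] is a variable of the formula, whether or not it
   occurs in some clause. *)
Record formula := Formula { vars : finType; clauses : {set clause vars} }.

Definition lit_true (V : finType) (a : {ffun V -> bool}) (l : literal V) : bool :=
  a l.1 == l.2.

Definition clause_true (V : finType) (a : {ffun V -> bool}) (c : clause V) : bool :=
  [exists l in c, lit_true a l].

Definition satisfiable (F : formula) : bool :=
  [exists a : {ffun vars F -> bool}, forall c in clauses F, clause_true a c].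

Definition minimal_unsatisfiable (F : formula) : bool :=
  ~~ satisfiable F &&
  [forall c in clauses F, satisfiable (Formula (clauses F :\ c))].

Definition kSAT (k : nat) (F : formula) : bool :=
  [forall c in clauses F, #|c| == k].

(* Main.v *)
Require Import Defs.
From mathcomp Require Import all_boot all_order all_algebra reals.

(** Call a clause of an unsatisfiable formula critical if deleting it makes the
    formula satisfiable.  An unsatisfiable formula contains a minimal
    unsatisfiable one, and the latter keeps every critical clause.  So it is
    enough to find an unsatisfiable [k]-SAT formula on [n] variables with
    order of [n ^ k] critical clauses.

    Take [k] blocks of [m] variables and, for each choice [f] of one variable
    per block, the positive clause [choice_clause f] on the chosen variables.
    Making exactly the chosen variables false falsifies this clause and no
    other one of its kind, so all [m ^ k] of them are critical, provided that
    the remaining clauses hold under all these assignments.  The remaining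
    clauses have to say that every block contains a false variable.  A single
    clause saying so has [m] literals, but [m] auxiliary variables per block
    express it by clauses of at most three literals: the auxiliary variable at
    position [p] means that the block has a false variable at a position up
    to [p] ([step_falsified]).

    Writing these down with exactly [k] literals is avoided by a semantic
    choice: put into the formula all [k]-clauses that hold under all the
    assignments above.  An assignment that falsifies a shorter clause with
    this property also falsifies a [k]-clause with this property, because the
    clause may be padded with further false literals ([falsified_extend],
    [critical_family]).  The blocks occupy [2 * k * m] variables, so [m] can be
    taken proportional to [n]. *)

Set Implicit Arguments.
Unset Strict Implicit.
Unset Printing Implicit Defensive.

Import Order.TTheory GRing.Theory Num.Theory.

(** * Critical clauses *)

Section Critical.

Variables (V : finType) (k : nat).
Implicit Types (b : {ffun V -> bool}) (C K : {set clause V}) (D : clause V).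

Lemma clause_trueP b D :
  reflect (exists2 l, l \in D & b l.1 = l.2) (clause_true b D).
Proof.
by apply: (iffP exists_inP) => -[l lD /eqP bl]; exists l => //; apply/eqP.
Qed.

Lemma sub_clause_true b D D' :
  D \subset D' -> clause_true b D -> clause_true b D'.
Proof.
by move=> /subsetP sDD' /clause_trueP[l /sDD' lD' bl]; apply/clause_trueP; exists l.
Qed.

Lemma unsatisfiableP C :
  reflect (forall b, exists2 D, D \in C & ~~ clause_true b D)
          (~~ satisfiable (Formula C)).
Proof.
rewrite negb_exists; apply: (iffP forallP) => [h b | h b].
  by have /forall_inPn[D DC nD] := h b; exists D.
by apply/forall_inPn; have [D DC nD] := h b; exists D.
Qed.

(** The clause is enlarged inside the set of the [#|V|] literals that are false
    under [b]; it contains no true literal to begin with. *)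
Lemma falsified_extend b D :
  k <= #|V| -> #|D| <= k -> ~~ clause_true b D ->
  exists D', [/\ D \subset D', #|D'| = k & ~~ clause_true b D'].
Proof.
move=> kV Dk nD.
pose L : clause V := [set (v, ~~ b v) | v : V].
have inL l : (l \in L) = (b l.1 != l.2).
  case: l => v s; apply/imsetP/idP => /= [[w _ [-> ->]] | bv].
    by case: (b w).
  by exists v => //; congr (_, _); move: bv; case: (b v); case: s.
have cardL : #|L| = #|V| by rewrite card_imset // => u v [].
have subL D' : (D' \subset L) = ~~ clause_true b D'.
  apply/subsetP/idP => [sD | nD' l lD'].
    by apply/clause_trueP => -[l /sD]; rewrite inL => /eqP.
  by rewrite inL; apply: contraNneq nD' => bl; apply/clause_trueP; exists l.
rewrite -subL in nD.
have /card_geqP[s [us sz sub]] : k - #|D| <= #|L :\: D|.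
  by rewrite cardsD (setIidPr nD) cardL leq_sub2r.
pose E := [set x in s].
have cE : #|E| = k - #|D| by rewrite cardsE (card_uniqP us).
have sE : E \subset L :\: D by apply/subsetP => x; rewrite inE; apply: sub.
have [sEL dED] : E \subset L /\ [disjoint E & D] by apply/andP; rewrite -subsetD.
exists (D :|: E); split; first exact: subsetUl.
  by rewrite cardsU setIC (disjoint_setI0 dED) cards0 subn0 cE subnKC.
by rewrite -subL subUset nD.
Qed.

(** Critical clauses survive in every unsatisfiable subformula, so any
    inclusion-minimal one has at least as many clauses as there are
    critical clauses. *)
Lemma minimal_unsatisfiable_sub C K :
  ~~ satisfiable (Formula C) ->
  (forall D, D \in K -> satisfiable (Formula (C :\ D))) ->
  exists C', [/\ C' \subset C, K \subset C' & minimal_unsatisfiable (Formula C')].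
Proof.
move=> nC crit.
have sat_sub (A B : {set clause V}) :
    A \subset B -> satisfiable (Formula B) -> satisfiable (Formula A).
  move=> /subsetP sAB /existsP[b /forall_inP bB]; apply/existsP; exists b.
  by apply/forall_inP => D /sAB; apply: bB.
have [C' /minsetP[nC' minC'] sC'C] :=
  minset_exists (P := fun A => ~~ satisfiable (Formula A)) nC.
exists C'; split=> //.
  apply/subsetP => D DK; apply: contraR nC' => DC'.
  by apply: sat_sub (crit D DK); rewrite subsetD1 sC'C.
apply/andP; split=> //; apply/forall_inP => D DC'.
apply: contraT => nD.
have eqC' := minC' _ nD (subD1set _ _).
by have := setD11 D C'; rewrite eqC' DC'.
Qed.

(** The formula consists of the [c i] and all [k]-clauses true under every
    [a i]; without [c i] it is satisfied by [a i]. *)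
Lemma critical_family (I : finType) (c : I -> clause V)
    (a : I -> {ffun V -> bool}) :
  k <= #|V| -> (forall i, #|c i| = k) ->
  (forall i j, clause_true (a i) (c j) = (i != j)) ->
  (forall b, (exists i, ~~ clause_true b (c i)) \/
     exists D : clause V,
       [/\ #|D| <= k, forall i, clause_true (a i) D & ~~ clause_true b D]) ->
  exists C : {set clause V},
    [/\ minimal_unsatisfiable (Formula C), kSAT k (Formula C) & #|I| <= #|C|].
Proof.
move=> kV ck ac unsat.
have c_inj : injective c.
  by move=> i j eqc; apply/eqP; rewrite -[_ == _]negbK -ac -eqc ac eqxx.
pose K := [set c i | i : I].
pose C := K :|: [set D : clause V | (#|D| == k) && [forall i, clause_true (a i) D]].
have nC : ~~ satisfiable (Formula C).
  apply/unsatisfiableP => b; case: (unsat b) => [[i ni] | [D [Dk aD nD]]].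
    by exists (c i) => //; rewrite inE imset_f.
  have [D' [sDD' cD' nD']] := falsified_extend kV Dk nD.
  exists D' => //; rewrite !inE cD' eqxx /=; apply/orP; right.
  by apply/forallP => i; apply: sub_clause_true (aD i).
have crit D : D \in K -> satisfiable (Formula (C :\ D)).
  case/imsetP => i _ ->; apply/existsP; exists (a i); apply/forall_inP => E /=.
  rewrite !inE => /andP[nE /orP[/imsetP[j _ eqE] | /andP[_ /forallP/(_ i)//]]].
  by rewrite eqE ac; apply: contraNneq nE => ->; rewrite eqE.
have [C' [sC'C sKC' mu]] := minimal_unsatisfiable_sub nC crit.
exists C'; split=> //; last first.
  by rewrite -(card_imset predT c_inj); apply: subset_leq_card.
apply/forall_inP => D /(subsetP sC'C); rewrite !inE => /orP[|/andP[] //].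
by case/imsetP => i _ ->; rewrite ck.
Qed.

End Critical.

(** * The block formula *)

Section Blocks.

Variables k m r : nat.

(** In [(j, p, s)], [j] is the block and [p] the position in it; [s] tells the
    variable itself from the auxiliary one.  The last summand holds spare
    variables, which bring the number of variables to a prescribed value. *)
Definition block_var : finType := ('I_k * 'I_m.+1 * bool + 'I_r)%type.
Definition main_var (j : 'I_k) (p : 'I_m.+1) : block_var := inl (j, p, true).
Definition aux_var (j : 'I_k) (p : 'I_m.+1) : block_var := inl (j, p, false).

Implicit Types f g : {ffun 'I_k -> 'I_m.+1}.

Definition choice_clause f : clause block_var :=
  [set (main_var j (f j), true) | j : 'I_k].

Definition choice_assignment f : {ffun block_var -> bool} :=
  [ffun v : block_var => match v with
             | inl (j, p, true) => p != f j
             | inl (j, p, false) => f j <= p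
             | inr _ => true
             end].

Lemma card_choice_clause f : #|choice_clause f| = k.
Proof. by rewrite card_imset ?card_ord // => i j []. Qed.

Lemma choice_clause_true f g :
  clause_true (choice_assignment f) (choice_clause g) = (f != g).
Proof.
apply/clause_trueP/idP => [[_ /imsetP[j _ ->]] | neq_fg].
  by rewrite ffunE /=; apply: contraTneq => ->; rewrite eqxx.
have /existsP[j neq_fgj] : [exists j, f j != g j].
  apply: contraNT neq_fg => /existsPn eq_fg.
  by apply/eqP/ffunP => j; apply/eqP/negPn.
exists (main_var j (g j), true); first exact: imset_f.
by rewrite ffunE /= eq_sym.
Qed.

(** Under a choice assignment, the last auxiliary variable of a block is true,
    and an auxiliary variable is true only if the previous one is true or the
    main variable at its own position is false.  If [b] makes every main
    variable of block [j] true, it violates the first property or, at the least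
    position with a true auxiliary variable, the second. *)
Lemma step_falsified (b : {ffun block_var -> bool}) (j : 'I_k) :
  (forall p, b (main_var j p)) ->
  exists D : clause block_var,
    [/\ #|D| <= 3, forall f, clause_true (choice_assignment f) D & ~~ clause_true b D].
Proof.
move=> bx; case: (boolP (b (aux_var j ord_max))) => [by_max | nby_max]; last first.
  exists [set (aux_var j ord_max, true)]; split; first by rewrite cards1.
    move=> f; apply/clause_trueP; exists (aux_var j ord_max, true).
      by rewrite inE.
    by rewrite ffunE /= -ltnS ltn_ord.
  by apply/clause_trueP => -[_ /set1P->]; apply/negP.
have [p by_p min_p] := arg_minnP (P := fun p => b (aux_var j p))
                         (fun p : 'I_m.+1 => p : nat) by_max.
have [p0 | p_gt0] := posnP p.
  exists [set (main_var j p, false); (aux_var j p, false)]; split.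
  - by rewrite cards2; case: (_ != _).
  - move=> f; apply/clause_trueP; have [fp | fp] := leqP (f j) p.
      exists (main_var j p, false); first by rewrite !inE eqxx.
      rewrite ffunE /=; apply/negbF/eqP/val_inj => /=.
      by apply/eqP; rewrite eqn_leq fp p0.
    exists (aux_var j p, false); first by rewrite !inE eqxx orbT.
    by rewrite ffunE /= leqNgt fp.
  - by apply/clause_trueP => -[_ /set2P[] ->] /=; rewrite ?bx ?by_p.
have q_lt : p.-1 < m.+1 by rewrite (leq_ltn_trans (leq_pred p)).
pose q := Ordinal q_lt.
exists [set (main_var j p, false); (aux_var j p, false); (aux_var j q, true)].
split.
- by rewrite -setUA !cardsU1 cards1; do 2!case: (_ \notin _).
- move=> f; apply/clause_trueP; have [fp | fp | fp] := ltngtP (f j) p.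
  + exists (aux_var j q, true); first by rewrite !inE eqxx !orbT.
    by rewrite ffunE /= -ltnS prednK.
  + exists (aux_var j p, false); first by rewrite !inE eqxx !orbT.
    by rewrite ffunE /= leqNgt fp.
  + exists (main_var j p, false); first by rewrite !inE eqxx.
    by rewrite ffunE /=; apply/negbF/eqP/val_inj.
- apply/clause_trueP => -[l]; rewrite !inE => /orP[/orP[]|] /eqP -> /=.
  + by rewrite bx.
  + by rewrite by_p.
  + by move=> /min_p /=; rewrite leqNgt prednK ?leqnn.
Qed.

Lemma block_falsified (b : {ffun block_var -> bool}) :
  3 <= k ->
  (exists f, ~~ clause_true b (choice_clause f)) \/
  exists D : clause block_var,
    [/\ #|D| <= k, forall f, clause_true (choice_assignment f) D & ~~ clause_true b D].
Proof.
move=> k3.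
case: (boolP [forall j, [exists p, ~~ b (main_var j p)]]) => [/forallP bF | ].
  have /fin_all_exists[f nf] j : exists p, ~~ b (main_var j p) by apply/existsP.
  left; exists (finfun f); apply/clause_trueP => -[_ /imsetP[j _ ->]] /=.
  by rewrite ffunE; apply/negP.
case/forallPn => j /existsPn bx; right.
have [D [D3 aD nD]] := step_falsified (fun p => negPn (bx p)).
by exists D; split=> //; apply: leq_trans k3.
Qed.

End Blocks.

(** * The lower bound *)

Local Open Scope ring_scope.

Theorem mainTheorem1 (R : realType) (k : nat) (hk : (3 <= k)%N) :
  exists (c : R) (n0 : nat), 0 < c /\
    forall n : nat, (n0 <= n)%N ->
      exists F : formula,
        [/\ minimal_unsatisfiable F, kSAT k F, #|vars F| = n
          & c * n%:R ^+ k <= #|clauses F|%:R].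
Proof.
have k_gt0 : (0 < k)%N by apply: leq_trans hk.
exists ((4 * k)%:R ^- k), (2 * k)%N; split.
  by rewrite invr_gt0 exprn_gt0 // ltr0n muln_gt0.
move=> n nk.
(* The blocks use [2 * k * m] variables for the largest possible [m]; as
   [m >= 1], this leaves [n < 2 * k * (m + 1) <= 4 * k * m]. *)
have k2_gt0 : (0 < 2 * k)%N by rewrite muln_gt0.
case def_m : (n %/ (2 * k))%N => [|m].
  by move/eqP: def_m; rewrite -leqn0 leqNgt divn_gt0 ?nk.
have le_n : (2 * k * m.+1 <= n)%N by rewrite mulnC -def_m leq_trunc_div.
have n_le : (n <= 4 * k * m.+1)%N.
  have := ltn_ceil n k2_gt0; rewrite def_m => /ltnW/leq_trans; apply.
  rewrite -[4%N]/(2 * 2)%N -mulnA [(k * _)%N]mulnC mulnACA leq_mul2r.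
  by rewrite (mul2n m.+1) doubleS !ltnS -addnn leq_addr orbT.
pose V := block_var k m (n - 2 * k * m.+1).
have cardV : #|V| = n.
  rewrite card_sum !card_prod !card_ord card_bool.
  by rewrite mulnC mulnA subnKC.
have kV : (k <= #|V|)%N.
  by rewrite cardV (leq_trans _ nk) // leq_pmull.
have [C [muC kC leC]] := critical_family kV (@card_choice_clause k m _)
  (@choice_clause_true k m _) (fun b => block_falsified b hk).
exists (Formula C); split=> //=.
rewrite card_ffun !card_ord in leC.
rewrite mulrC ler_pdivrMr ?exprn_gt0 ?ltr0n ?muln_gt0 ?k_gt0 //.
apply: (@le_trans _ _ ((m.+1 ^ k)%:R * (4 * k)%:R ^+ k)).
  by rewrite -!natrX -natrM ler_nat -expnMn leq_exp2r // mulnC.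
by rewrite ler_wpM2r ?ler_nat // exprn_ge0.
Qed.
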